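(* Let $\hat{\mathcal G}=(\mathcal V,\hat{\mathcal E})$ be a connected graph with positive line susceptances, let $\mathcal G_e=(\mathcal V,\mathcal E_e)$ with $\mathcal E_e\subseteq\hat{\mathcal E}$ be a connected (existing) network, and let $\tilde L_f$ and $\tilde L_e$ be the reduced susceptance Laplacians of $\hat{\mathcal G}$ and $\mathcal G_e$, respectively. Let $X$ be a real symmetric $N\times N$ matrix, indexed by $\mathcal V_r$, such that $\tilde L_f^{-1}\preceq X\preceq \tilde L_e^{-1}$. Then the diagonal entries of $X$ satisfy $$[\tilde L_f^{-1}]_{ii}\le X_{ii}\le[\tilde L_e^{-1}]_{ii}\qquad\text{for all } i\in\mathcal V_r,$$ and its off-diagonal entries satisfy, for all $i,j\in\mathcal V_r$ with $j\ne i$, $$X_{ij}\le[\tilde L_f^{-1}]_{ij}+\sqrt{\left([\tilde L_e^{-1}]_{jj}-[\tilde L_f^{-1}]_{jj}\right)\left([\tilde L_e^{-1}]_{ii}-[\tilde L_f^{-1}]_{ii}\right)},$$ $$X_{ij}\ge[\tilde L_e^{-1}]_{ij}-\sqrt{\left([\tilde L_e^{-1}]_{jj}-[\tilde L_f^{-1}]_{jj}\right)\left([\tilde L_e^{-1}]_{ii}-[\tilde L_f^{-1}]_{ii}\right)}.$$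
   Context: The node set is $\mathcal V=\{1,\dots,N+1\}$, node $1$ is the reference node, and $\mathcal V_r=\mathcal V\setminus\{1\}$; $N\times N$ matrices and vectors of length $N$ are indexed by $\mathcal V_r$. Graphs are undirected, and each line $(i,j)\in\hat{\mathcal E}$ has susceptance $b_{ij}>0$. For $i\in\mathcal V_r$ let $e_i\in\mathbb R^N$ be the canonical vector, with the convention $e_1=0$ for the reference node; for a line $(i,j)$ let $a_{ij}=e_i-e_j$ (the corresponding row of the reduced branch-bus incidence matrix, viewed as a column vector). The reduced susceptance Laplacian of $(\mathcal V,\mathcal E)$ is $\sum_{(i,j)\in\mathcal E}b_{ij}a_{ij}a_{ij}^\top$, i.e. the susceptance-weighted graph Laplacian with the row and column of node $1$ removed; it is invertible when the graph is connected. Thus $\tilde L_f=\sum_{(i,j)\in\hat{\mathcal E}}b_{ij}a_{ij}a_{ij}^\top$ and $\tilde L_e=\sum_{(i,j)\in\mathcal E_e}b_{ij}a_{ij}a_{ij}^\top$. $P\preceq Q$ means that $Q-P$ is positive semidefinite. *)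

(* Defs.v *)
From mathcomp Require Import all_boot all_order all_algebra.
From mathcomp Require Import reals.

Set Implicit Arguments.
Unset Strict Implicit.
Unset Printing Implicit Defensive.

Import Order.TTheory GRing.Theory Num.Theory.

#[global] Open Scope ring_scope.

(* The N+1 nodes are 'I_N.+1, with ord0 as the reference node; the row (or
   column) k : 'I_N of a reduced matrix stands for the node lift ord0 k. *)

Definition node_vec (R : realType) (N : nat) (v : 'I_N.+1) : 'cV[R]_N :=
  if unlift ord0 v is Some k then delta_mx k 0 else 0.

Definition line_vec (R : realType) (N : nat) (i j : 'I_N.+1) : 'cV[R]_N :=
  node_vec R i - node_vec R j.

Definition connected_graph (V : finType) (E : rel V) : Prop :=
  forall u v : V, connect E u v.

(* For a symmetric and irreflexive E, the condition i < j selects exactly one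
   orientation of each undirected line. *)
Definition reduced_laplacian (R : realType) (N : nat) (E : rel 'I_N.+1)
    (b : 'I_N.+1 -> 'I_N.+1 -> R) : 'M[R]_N :=
  \sum_(i < N.+1) \sum_(j < N.+1 | (i < j)%N && E i j)
    b i j *: (line_vec R i j *m (line_vec R i j)^T).

Definition psdmx (R : realType) (N : nat) (A : 'M[R]_N) : Prop :=
  A^T = A /\ forall x : 'cV[R]_N, 0 <= (x^T *m A *m x) 0 0.

Definition loewner_le (R : realType) (N : nat) (P Q : 'M[R]_N) : Prop :=
  psdmx (Q - P).

(* Main.v *)
Require Import Defs.
From mathcomp Require Import all_boot all_order all_algebra.
From mathcomp Require Import reals.
From mathcomp Require Import ring lra.

Set Implicit Arguments.
Unset Strict Implicit.
Unset Printing Implicit Defensive.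

Import Order.TTheory GRing.Theory Num.Theory.

(** Both X - Lf^-1 and Le^-1 - X are positive semidefinite, and their diagonal
    entries are at most those of their sum Le^-1 - Lf^-1.  The off-diagonal
    bounds are then the 2 x 2 minor inequality D_ij^2 <= D_ii D_jj of a
    positive semidefinite D, applied to each of the two differences. *)

Lemma binary_form_discr (R : realFieldType) (p q r : R) :
  (forall t s : R, 0 <= p * t ^+ 2 + 2 * q * t * s + r * s ^+ 2) ->
  q ^+ 2 <= p * r.
Proof.
move=> form_ge0.
have p_ge0 : 0 <= p by have := form_ge0 1 0; lra.
have r_ge0 : 0 <= r by have := form_ge0 0 1; lra.
have [r0|r_neq0] := eqVneq r 0.
  (* With [r = 0] the form at this point is [- (p + 2) * q ^+ 2]. Shifting [p] by 1 keeps the factor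
     [p + 2] positive even when [p = 0], so [q] must vanish. *)
  have := form_ge0 q (- (p + 1)); rewrite r0.
  have -> : p * q ^+ 2 + 2 * q * q * - (p + 1) + 0 * (- (p + 1)) ^+ 2
            = - ((p + 2) * q ^+ 2) by ring.
  by rewrite oppr_ge0 pmulr_rle0 ?mulr0 //; lra.
have r_gt0 : 0 < r by rewrite lt_def r_neq0.
(* For [t = r] the form is minimal in [s] at [s = - q], where its value is [r] times the
   determinant. *)
have := form_ge0 r (- q).
have -> : p * r ^+ 2 + 2 * q * r * - q + r * (- q) ^+ 2
          = r * (p * r - q ^+ 2) by ring.
by rewrite pmulr_rge0 // subr_ge0.
Qed.

Lemma delta_form (R : comNzRingType) (N : nat) (A : 'M[R]_N) (i j : 'I_N) :
  (delta_mx i 0 : 'cV[R]_N)^T *m A *m (delta_mx j 0 : 'cV[R]_N)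
  = (A i j)%:M.
Proof.
by rewrite trmx_delta -rowE -colE [LHS]mx11_scalar !mxE.
Qed.

Lemma psdmx_diag_ge0 (R : realType) (N : nat) (A : 'M[R]_N) (i : 'I_N) :
  psdmx A -> 0 <= A i i.
Proof.
by case=> _ /(_ (delta_mx i 0)); rewrite delta_form !mxE.
Qed.

(** On combinations of the basis vectors [i] and [j] the quadratic form of [A] is a binary form;
    symmetry merges its two cross terms into [2 * A i j * t * s]. *)
Lemma psdmx_minor2 (R : realType) (N : nat) (A : 'M[R]_N) (i j : 'I_N) :
  psdmx A -> A i j ^+ 2 <= A i i * A j j.
Proof.
case=> A_sym A_ge0; apply: binary_form_discr => t s.
have := A_ge0 (t *: delta_mx i 0 + s *: delta_mx j 0).
have Aji : A j i = A i j by rewrite -[in LHS]A_sym mxE.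
rewrite [(_ + _)^T]linearD /= ![(_ *: _)^T]linearZ /= !mulmxDl !mulmxDr -!scalemxAl -!scalemxAr.
rewrite !delta_form !mxE Aji /= !mulr1n.
by congr (_ <= _); ring.
Qed.

Lemma psdmx_entry_le_sqrt (R : realType) (N : nat) (A : 'M[R]_N) (i j : 'I_N)
    (u v : R) :
  psdmx A -> A i i <= u -> A j j <= v -> A i j <= Num.sqrt (v * u).
Proof.
move=> psdA leu lev; apply: le_trans (ler_norm _) _.
rewrite -sqrtr_sqr; apply: ler_wsqrtr.
rewrite mulrC; apply: le_trans (psdmx_minor2 i j psdA) _.
by apply: ler_pM; rewrite ?psdmx_diag_ge0.
Qed.

Theorem lemma1 (R : realType) (N : nat)
    (Ef Ee : rel 'I_N.+1) (b : 'I_N.+1 -> 'I_N.+1 -> R) (X : 'M[R]_N)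
    (Ef_sym : symmetric Ef) (Ef_irr : irreflexive Ef)
    (Ee_sym : symmetric Ee) (Ee_sub : subrel Ee Ef)
    (b_sym : forall i j, b i j = b j i)
    (b_pos : forall i j, Ef i j -> 0 < b i j)
    (Ef_conn : connected_graph Ef) (Ee_conn : connected_graph Ee)
    (X_sym : X^T = X)
    (X_ge : loewner_le (invmx (reduced_laplacian Ef b)) X)
    (X_le : loewner_le X (invmx (reduced_laplacian Ee b))) :
  let Lfi := invmx (reduced_laplacian Ef b) in
  let Lei := invmx (reduced_laplacian Ee b) in
  (forall i : 'I_N, Lfi i i <= X i i <= Lei i i) /\
  (forall i j : 'I_N, j != i ->
     X i j <= Lfi i j
              + Num.sqrt ((Lei j j - Lfi j j) * (Lei i i - Lfi i i)) /\
     Lei i j - Num.sqrt ((Lei j j - Lfi j j) * (Lei i i - Lfi i i)) <= X i j).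
Proof.
move=> Lfi Lei.
have diag_ge i : Lfi i i <= X i i.
  by have := psdmx_diag_ge0 i X_ge; rewrite !mxE subr_ge0.
have diag_le i : X i i <= Lei i i.
  by have := psdmx_diag_ge0 i X_le; rewrite !mxE subr_ge0.
split=> [i|i j _]; first by rewrite diag_ge diag_le.
(* The roles cross: [X_ge] yields the upper off-diagonal bound, its diagonal premises coming from
   [diag_le], while [X_le] yields the lower one through [diag_ge]. *)
have lo := @psdmx_entry_le_sqrt _ _ _ i j (Lei i i - Lfi i i)
  (Lei j j - Lfi j j) X_ge.
have hi := @psdmx_entry_le_sqrt _ _ _ i j (Lei i i - Lfi i i)
  (Lei j j - Lfi j j) X_le.
rewrite !mxE -/Lfi in lo; rewrite !mxE -/Lei in hi.
split.
  by rewrite -lerBlDl; apply: lo; rewrite lerD2r.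
by rewrite lerBlDr -lerBlDl; apply: hi; rewrite lerD2l lerN2.
Qed.
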